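(* If $\Gamma$ is any abelian group and $G$ is a graph with $|\Gamma|$ vertices such that $G$ has at least two distinct vertices of degree $|\Gamma|-1$, then $G$ is not $\Gamma$-distance magic.
   Context: All graphs are finite and simple; all groups are finite additive abelian groups. $N_G(u)$ is the set of vertices adjacent to $u$ in $G$, and the degree of $u$ is $|N_G(u)|$. For a graph $G$ and an abelian group $\Gamma$ with $|V(G)|=|\Gamma|$, a $\Gamma$-distance magic labeling of $G$ is a bijection $l:V(G)\to\Gamma$ for which there is an element $\mu_0\in\Gamma$ such that $w_G(u)=\sum_{v\in N_G(u)}l(v)=\mu_0$ for every $u\in V(G)$; $G$ is $\Gamma$-distance magic if it admits such a labeling. *)

(* Defs.v *)
From HB Require Import structures.
From mathcomp Require Import all_boot all_order all_algebra.

Set Implicit Arguments.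
Unset Strict Implicit.
Unset Printing Implicit Defensive.

Import GRing.Theory.
Local Open Scope ring_scope.

Record sgraph (V : finType) := SGraph {
  adj :> rel V;
  adj_sym : symmetric adj;
  adj_irrefl : irreflexive adj
}.

Definition neighbors (V : finType) (G : sgraph V) (u : V) : {set V} :=
  [set v | adj G u v].

Definition degree (V : finType) (G : sgraph V) (u : V) : nat :=
  #|neighbors G u|.

Definition weight (V : finType) (G : sgraph V) (Gamma : finZmodType)
    (l : V -> Gamma) (u : V) : Gamma :=
  \sum_(v in neighbors G u) l v.

(* The standing requirement #|V| = #|Gamma| is forced by bijectivity of l. *)
Definition distance_magic_labeling (V : finType) (G : sgraph V)
    (Gamma : finZmodType) (l : V -> Gamma) : Prop :=
  bijective l /\ exists mu0 : Gamma, forall u : V, weight G l u = mu0.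

Definition distance_magic (V : finType) (G : sgraph V) (Gamma : finZmodType) :
    Prop :=
  exists l : V -> Gamma, distance_magic_labeling G l.

(* Main.v *)
(* A vertex u adjacent to all others has weight S - l u, where S is the sum of
   all labels; two such vertices of equal weight would carry the same label. *)
Require Import Defs.
From mathcomp Require Import all_boot all_order all_algebra.

Import GRing.Theory.

(** With [S] the sum of all labels, [weight_full_degree] turns equal weights at two full-degree
    vertices into [S - l u = S - l v]; cancelling [S] contradicts injectivity of [l]. *)

Lemma neighbors_full_degree (V : finType) (G : sgraph V) (u : V) :
  degree G u = (#|V| - 1)%N -> neighbors G u = [set~ u].
Proof.
(* The two sets have equal size, so one inclusion suffices; it is the absence of loops. *)
move=> degu; apply/eqP; rewrite eqEcard cardsC1 -subn1 -degu leqnn andbT.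
by apply/subsetP=> v; rewrite !inE; apply: contraTneq => ->; rewrite adj_irrefl.
Qed.

Lemma weight_full_degree (V : finType) (G : sgraph V) (Gamma : finZmodType)
    (l : V -> Gamma) (u : V) :
  degree G u = (#|V| - 1)%N -> weight G l u = (\sum_v l v - l u)%R.
Proof.
move=> /neighbors_full_degree nbu; rewrite /weight nbu [in RHS](bigD1 u) //= [RHS]addrC addKr.
by apply: eq_bigl => v; rewrite !inE.
Qed.

Theorem lemma2p1 (Gamma : finZmodType) (V : finType) (G : sgraph V)
    (cardV : #|V| = #|Gamma|)
    (twoV : exists u v : V, [/\ u <> v,
       degree G u = (#|Gamma| - 1)%N & degree G v = (#|Gamma| - 1)%N]) :
  ~ distance_magic G Gamma.
Proof.
case: twoV => u [v [neq_uv degu degv]] [l [/bij_inj l_inj [mu0 magic]]].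
rewrite -cardV in degu degv.
(* Backwards from [u = v] to equality of the two weights, both [mu0]. *)
apply/neq_uv/l_inj/oppr_inj/(addrI (\sum_w l w)%R).
by rewrite -!(weight_full_degree _ G) // !magic.
Qed.
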